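(* Let $u\in C^2(\mathbb{R}^2\setminus\{0\})$ be a radially symmetric, real-valued solution of $$-\Delta u=\frac{2}{|x|^2}\,u\,(1-u^2)\quad\text{in } \mathbb{R}^2\setminus\{0\}.$$ (i) If $u$ is continuous at the origin, then either $u\equiv 0$ in $\mathbb{R}^2$, or there exist $a\in\mathbb{R}$ and a choice of sign such that $$u(x)=\pm\frac{a^2-|x|^2}{a^2+|x|^2}\quad\text{in }\mathbb{R}^2 .$$ (ii) If $u$ is discontinuous at the origin, then the function $v(t):=u(e^t)$, $t\in\mathbb{R}$, is a periodic function on $\mathbb{R}$. Moreover, there is $M\in(0,1)$ such that $v$ has maximum value $M$ and minimum value $-M$; up to a translation in $t$, $v$ is characterized by these values (i.e. if $u_1,u_2$ are two such discontinuous radial solutions whose associated functions $v_1,v_2$ have the same maximum value $M$ and minimum value $-M$, then $v_2(t)=v_1(t+s)$ for all $t\in\mathbb{R}$, for some $s\in\mathbb{R}$); and the period $T$ of $v$ is given by $$T=2\int_{-M}^{M}\frac{\mathrm{d}\theta}{\sqrt{(2-M^2-\theta^2)(M^2-\theta^2)}} .$$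
   Context: A radially symmetric function $u$ on $\mathbb{R}^2\setminus\{0\}$ depends only on $r=|x|$, and $u(e^t)$ denotes its value at points with $|x|=e^t$. ''Continuous at the origin'' means that $\lim_{x\to 0}u(x)$ exists in $\mathbb{R}$, in which case $u$ is extended to the origin by this limit; ''discontinuous at the origin'' means that this limit does not exist in $\mathbb{R}$. When $a=0$, the expression $\frac{a^2-|x|^2}{a^2+|x|^2}$ is read as the constant function $-1$ on all of $\mathbb{R}^2$ (including $x=0$). The period $T$ is the smallest positive period of $v$. *)

(* Defs.v *)
From Stdlib Require Import Reals.
From Coquelicot Require Import Coquelicot.
Open Scope R_scope.

(* A function on R^2 \ {0} is a total function u : R -> R -> R whose value at
   the origin is never used. *)

Definition enorm (x y : R) : R := sqrt (x ^ 2 + y ^ 2).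

Definition C2_off_origin (u : R -> R -> R) : Prop :=
  forall x y, (x, y) <> (0, 0) -> ex_diff_n u 2 x y.

Definition radial (u : R -> R -> R) : Prop :=
  forall x y x' y', (x, y) <> (0, 0) -> (x', y') <> (0, 0) ->
    enorm x y = enorm x' y' -> u x y = u x' y'.

Definition laplacian (u : R -> R -> R) (x y : R) : R :=
  partial_derive 2 0 u x y + partial_derive 0 2 u x y.

Definition solves_equation (u : R -> R -> R) : Prop :=
  forall x y, (x, y) <> (0, 0) ->
    - laplacian u x y = 2 / enorm x y ^ 2 * u x y * (1 - u x y ^ 2).

Definition radial_solution (u : R -> R -> R) : Prop :=
  C2_off_origin u /\ radial u /\ solves_equation u.

(* [locally'] is the filter of punctured neighbourhoods. *)
Definition limit_at_origin (u : R -> R -> R) (l : R) : Prop :=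
  filterlim (fun p : R * R => u (fst p) (snd p))
    (locally' ((0, 0) : R * R)) (locally l).

Definition continuous_at_origin (u : R -> R -> R) : Prop :=
  exists l : R, limit_at_origin u l.

Definition extend_at_origin (u : R -> R -> R) (l : R) (x y : R) : R :=
  if Req_EM_T (enorm x y) 0 then l else u x y.

Definition kink (a x y : R) : R :=
  if Req_EM_T a 0 then -1
  else (a ^ 2 - enorm x y ^ 2) / (a ^ 2 + enorm x y ^ 2).

(* t |-> u(e^t); by radial symmetry any point of norm e^t may be used. *)
Definition log_profile (u : R -> R -> R) (t : R) : R := u (exp t) 0.

Definition has_max (v : R -> R) (M : R) : Prop :=
  (exists t, v t = M) /\ forall t, v t <= M.

Definition has_min (v : R -> R) (m : R) : Prop :=
  (exists t, v t = m) /\ forall t, m <= v t.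

Definition positive_period (v : R -> R) (T : R) : Prop :=
  0 < T /\ forall t, v (t + T) = v t.

Definition smallest_period (v : R -> R) (T : R) : Prop :=
  positive_period v T /\ forall T', positive_period v T' -> T <= T'.

Definition period_integrand (M theta : R) : R :=
  1 / sqrt ((2 - M ^ 2 - theta ^ 2) * (M ^ 2 - theta ^ 2)).

(* Main.v *)
(** In the variable [t = ln |x|] the equation becomes [v'' = - 2 v (1 - v^2)], with
    conserved quantity [w^2 - (1 - v^2)^2 = (w - (1 - v^2)) (w + (1 - v^2))], where
    [w = v'].  A solution defined on the whole line satisfies [|v| <= 1], since it blows
    up in finite time otherwise; hence the conserved quantity lies in [[-1, 0]].
    At [-1], [v] vanishes; at [0], [v' = 1 - v^2] or [v' = - (1 - v^2)], which gives the
    kinks.  In between it equals [- (1 - M^2)^2] with [0 < M < 1], and then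
    [v = M sin phi] with [phi' = sqrt (2 - M^2 - M^2 sin^2 phi)].  Separating variables
    yields an increasing function of [phi] that equals [t] up to a constant, whence
    periodicity, the period and uniqueness up to translation. *)

Require Import Defs.
From Stdlib Require Import Reals Lra.
From Coquelicot Require Import Coquelicot.
Open Scope R_scope.

(** * Calculus: mean value bounds and first-order linear equations *)

Lemma derive_lower_bound (f f' : R -> R) (a b c : R) :
  a <= b -> (forall t, a <= t <= b -> is_derive f t (f' t)) ->
  (forall t, a <= t <= b -> c <= f' t) -> c * (b - a) <= f b - f a.
Proof.
  intros hab hf hc.
  destruct (MVT_gen f a b f') as [s [hs ->]];
    rewrite ?Rmin_left, ?Rmax_right in * by lra.
  - intros x hx; apply hf; lra.
  - intros x hx; apply continuity_pt_filterlim, (ex_derive_continuous f).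
    exists (f' x); apply hf; lra.
  - apply Rmult_le_compat_r; [lra | auto].
Qed.

Lemma derive_zero_const (f : R -> R) :
  (forall t, is_derive f t 0) -> forall s t, f s = f t.
Proof.
  intros hf s t.
  destruct (MVT_gen f t s (fun _ => 0)) as [x [_ hx]].
  - intros; apply hf.
  - intros x _; apply continuity_pt_filterlim, (ex_derive_continuous f).
    exists 0; apply hf.
  - lra.
Qed.

Lemma RInt_derive (f : R -> R) (a t : R) :
  (forall x, continuous f x) -> is_derive (fun x => RInt f a x) t (f t).
Proof.
  intros hf; apply (is_derive_RInt f (fun x => RInt f a x) a t); [| apply hf].
  apply filter_forall; intros x.
  apply (@RInt_correct R_CompleteNormedModule), ex_RInt_continuous; auto.
Qed.

(** Integrating factor: [f t * exp (- RInt k a t)] has zero derivative. *)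
Lemma linear_ode (f k : R -> R) :
  (forall t, continuous k t) -> (forall t, is_derive f t (k t * f t)) ->
  forall a t, f t = f a * exp (RInt k a t).
Proof.
  intros hk hf a t.
  assert (H : f t * exp (- RInt k a t) = f a * exp (- RInt k a a)).
  { apply (derive_zero_const (fun t => f t * exp (- RInt k a t))); intros s.
    evar_last.
    - apply (is_derive_mult f (fun t => exp (- RInt k a t))); [apply hf | | apply Rmult_comm].
      apply (is_derive_comp exp (fun t => - RInt k a t)); [apply is_derive_exp |].
      apply (is_derive_opp (fun t => RInt k a t)), RInt_derive, hk.
    - unfold plus, scal, opp; simpl; unfold mult; simpl; ring. }
  rewrite RInt_point in H; change (@zero _) with 0 in H.
  rewrite Ropp_0, exp_0, Rmult_1_r in H.
  rewrite <- H, Rmult_assoc, <- exp_plus.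
  replace (- RInt k a t + RInt k a t) with 0 by ring.
  rewrite exp_0; ring.
Qed.

(** * The first-order system: symmetries, first integral and global bounds *)

Definition phase_ode (v w : R -> R) : Prop :=
  forall t, is_derive v t (w t) /\
            is_derive w t (- (2 * v t * (1 - v t ^ 2))).

Lemma phase_ode_continuous v w :
  phase_ode v w -> forall t, continuous v t /\ continuous w t.
Proof.
  intros h t; destruct (h t) as [h1 h2]; split;
    apply (@ex_derive_continuous R_AbsRing R_NormedModule); eexists; eauto.
Qed.

Ltac derive_from h t :=
  destruct (h t) as [?hv ?hw]; auto_derive;
  [ repeat split; try (eexists; eassumption)
  | repeat match goal with
           | H : is_derive ?f t ?l |- _ =>
             rewrite ?(is_derive_unique (fun x : R => f x) t l H); clear H
           end].

Lemma phase_ode_opp v w :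
  phase_ode v w -> phase_ode (fun t => - v t) (fun t => - w t).
Proof. intros h t; split; derive_from h t; ring. Qed.

Lemma phase_ode_reverse v w :
  phase_ode v w -> phase_ode (fun t => v (- t)) (fun t => - w (- t)).
Proof.
  intros h t; split; derive_from h (- t); ring.
Qed.

(* The first integral [w^2 - (1 - v^2)^2] factors, and each factor solves a linear equation of first order. *)
Lemma left_factor v w :
  phase_ode v w -> forall a t,
  w t - (1 - v t ^ 2) = (w a - (1 - v a ^ 2)) * exp (RInt (fun s => 2 * v s) a t).
Proof.
  intros h a t.
  apply (linear_ode (fun t => w t - (1 - v t ^ 2)) (fun s => 2 * v s)).
  - intros s; apply (continuous_scal_r 2 v), (phase_ode_continuous v w h).
  - intros s; derive_from h s; ring.
Qed.

Lemma right_factor v w :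
  phase_ode v w -> forall a t,
  w t + (1 - v t ^ 2) = (w a + (1 - v a ^ 2)) * exp (RInt (fun s => - (2 * v s)) a t).
Proof.
  intros h a t.
  apply (linear_ode (fun t => w t + (1 - v t ^ 2)) (fun s => - (2 * v s))).
  - intros s; apply (continuous_opp (fun s => 2 * v s)), (continuous_scal_r 2 v), (phase_ode_continuous v w h).
  - intros s; derive_from h s; ring.
Qed.

Lemma energy v w :
  phase_ode v w -> forall s t,
  w s ^ 2 - (1 - v s ^ 2) ^ 2 = w t ^ 2 - (1 - v t ^ 2) ^ 2.
Proof.
  intros h.
  apply (derive_zero_const (fun t => w t ^ 2 - (1 - v t ^ 2) ^ 2)); intros t.
  derive_from h t; ring.
Qed.

(** The left factor stays positive, which keeps [v] above 1; then [w] increases and [v] grows at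
    least linearly. Once [v] is large, the energy gives [v' >= v^2 / 2], and [- / v] would outgrow
    its bound in finite time. *)
Lemma blow_up v w t0 : phase_ode v w -> 1 < v t0 -> 0 <= w t0 -> False.
Proof.
  intros h hv hw.
  assert (dv : forall t, is_derive v t (w t)) by apply h.
  assert (H1 : forall t, w t > 1 - v t ^ 2).
  { intros t.
    assert (H := left_factor v w h t0 t).
    assert (0 < w t0 - (1 - v t0 ^ 2)) by nra.
    assert (E := exp_pos (RInt (fun s => 2 * v s) t0 t)).
    nra. }
  assert (H2 : forall t, t0 <= t -> 1 < v t).
  { intros t ht.
    assert (hc : forall s, continuous (fun s => v s + 1) s).
    { intros s; apply (continuous_plus v (fun _ => 1));
        [apply (phase_ode_continuous v w h) | apply continuous_const]. }
    (* Since [w > (1 - v) * (1 + v)], the factor [exp m] makes [(v - 1) * exp m] nondecreasing. *)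
    set (m := fun t => RInt (fun s => v s + 1) t0 t).
    assert (dm : forall s, is_derive m s (v s + 1)).
    { intros s; apply (RInt_derive (fun s => v s + 1)); auto. }
    assert (H := derive_lower_bound (fun s => (v s - 1) * exp (m s))
      (fun s => (w s - (1 - v s ^ 2)) * exp (m s)) t0 t 0 ht).
    assert (0 * (t - t0) <= (v t - 1) * exp (m t) - (v t0 - 1) * exp (m t0)).
    { apply H.
      - intros s _; specialize (dv s); specialize (dm s).
        auto_derive; [repeat split; eexists; eassumption|].
        rewrite (is_derive_unique (fun x : R => v x) s _ dv),
          (is_derive_unique (fun x : R => m x) s _ dm); ring.
      - intros s _; specialize (H1 s); assert (E := exp_pos (m s)); nra. }
    assert (E := exp_pos (m t)); assert (E0 := exp_pos (m t0)); nra. }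
  assert (H3 : forall a b, t0 <= a <= b -> w a <= w b).
  { intros a b hab.
    assert (H := derive_lower_bound w (fun t => - (2 * v t * (1 - v t ^ 2))) a b 0).
    enough (0 * (b - a) <= w b - w a) by lra.
    apply H; [lra | intros; apply h |].
    intros t ht; assert (1 < v t) by (apply H2; lra).
    assert (0 < v t * (v t ^ 2 - 1)) by (apply Rmult_lt_0_compat; nra); lra. }
  (* [w t0] may be 0; one unit of time, during which [w' >= c > 0], makes the speed positive. *)
  assert (H4 : 0 < w (t0 + 1)).
  { set (c := 2 * v t0 * (v t0 ^ 2 - 1)).
    assert (H5 : forall t, t0 <= t -> v t0 <= v t).
    { intros t ht.
      enough (0 * (t - t0) <= v t - v t0) by lra.
      apply (derive_lower_bound v w); auto.
      intros s hs; specialize (H3 t0 s); lra. }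
    assert (H := derive_lower_bound w (fun t => - (2 * v t * (1 - v t ^ 2))) t0 (t0 + 1) c).
    assert (c * (t0 + 1 - t0) <= w (t0 + 1) - w t0).
    { apply H; [lra | intros; apply h |].
      intros t ht; unfold c; specialize (H5 t (proj1 ht)).
      assert (v t0 * (v t0 ^ 2 - 1) <= v t * (v t ^ 2 - 1)); [|lra].
      apply Rmult_le_compat; nra. }
    assert (0 < c) by (unfold c; apply Rmult_lt_0_compat; nra).
    lra. }
  set (t1 := t0 + 1) in *.
  set (e := w t0 ^ 2 - (1 - v t0 ^ 2) ^ 2).
  (* With [y = v^2], the bounds [y >= K >= 4] and [K >= - e] give [(y - 1)^2 + e >= y^2 / 4], whose
     left side is [w^2]. *)
  set (K := 4 + 2 * Rabs e).
  assert (hK : 4 <= K) by (unfold K; assert (A := Rabs_pos e); lra).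
  (* Growth at rate at least [w t1] covers a distance [K] within time [K / w t1]. *)
  set (t2 := t1 + K / w t1).
  assert (h12 : 0 < K / w t1) by (apply Rdiv_lt_0_compat; lra).
  assert (H6 : forall t, t2 <= t -> K <= v t).
  { intros t ht; unfold t2 in ht.
    assert (w t1 * (t - t1) <= v t - v t1).
    { apply (derive_lower_bound v w); [lra | auto |].
      intros s hs; apply H3; unfold t1 in *; lra. }
    assert (w t1 * (K / w t1) <= w t1 * (t - t1)) by (apply Rmult_le_compat_l; lra).
    replace (w t1 * (K / w t1)) with K in * by (field; lra).
    assert (1 < v t1) by (apply H2; unfold t1; lra); lra. }
  assert (H7 : forall t, t2 <= t -> v t ^ 2 / 2 <= w t).
  { intros t ht; specialize (H6 t ht).
    assert (hw1 : 0 <= w t).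
    { assert (w t1 <= w t) by (apply H3; unfold t2, t1 in *; lra); lra. }
    assert (He := energy v w h t t0); fold e in He.
    assert (Ha := Rle_abs (- e)); rewrite Rabs_Ropp in Ha.
    apply Rsqr_incr_0_var; auto; unfold Rsqr.
    set (y := v t ^ 2) in *.
    assert (hy : K <= y) by (unfold y; nra).
    assert (- e <= K) by (unfold K in *; assert (A := Rabs_pos e); lra).
    nra. }
  (* Over two units of time [- / v] would gain at least 1, although [/ v] lies strictly between 0
     and 1. *)
  set (t3 := t2 + 2).
  assert (H := derive_lower_bound (fun t => - / v t) (fun t => w t / v t ^ 2) t2 t3 (1/2)).
  assert (1/2 * (t3 - t2) <= - / v t3 - - / v t2).
  { apply H; [unfold t3; lra | |].
    - intros t ht; assert (K <= v t) by (apply H6; lra).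
      specialize (dv t); auto_derive.
      + repeat split; [eexists; eassumption | lra].
      + rewrite (is_derive_unique (fun x : R => v x) t _ dv); field; lra.
    - intros t ht; assert (K <= v t) by (apply H6; lra).
      assert (v t ^ 2 / 2 <= w t) by (apply H7; lra).
      apply Rmult_le_reg_r with (v t ^ 2); [nra |].
      replace (w t / v t ^ 2 * v t ^ 2) with (w t) by (field; lra); lra. }
  assert (K <= v t2) by (apply H6; lra).
  assert (K <= v t3) by (apply H6; unfold t3; lra).
  assert (/ v t2 < 1) by (rewrite <- Rinv_1; apply Rinv_lt_contravar; lra).
  assert (0 < / v t3) by (apply Rinv_0_lt_compat; lra).
  unfold t3 in *; lra.
Qed.

(** Time reversal turns a decreasing [v] above 1 into an increasing one, so blow-up applies in
    either case; [v -> - v] gives the lower bound. *)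
Lemma phase_ode_bounded v w : phase_ode v w -> forall t, -1 <= v t <= 1.
Proof.
  assert (up : forall v w, phase_ode v w -> forall t, v t <= 1).
  { intros v' w' h t; apply Rnot_lt_le; intros hv.
    destruct (Rle_or_lt 0 (w' t)) as [hw | hw].
    - exact (blow_up v' w' t h hv hw).
    - apply (blow_up _ _ (- t) (phase_ode_reverse v' w' h)); rewrite Ropp_involutive; lra. }
  intros h t; assert (H := up _ _ (phase_ode_opp v w h) t); simpl in H.
  specialize (up v w h t); lra.
Qed.

(** Positive energy keeps [w^2] above a positive constant, so [v] would move too far to remain in
    [[-1, 1]]. *)
Lemma energy_nonpos v w : phase_ode v w -> forall t, w t ^ 2 <= (1 - v t ^ 2) ^ 2.
Proof.
  intros h t; apply Rnot_lt_le; intros he.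
  set (e := w t ^ 2 - (1 - v t ^ 2) ^ 2).
  assert (0 < e) by (unfold e; lra).
  (* Chosen so that [T^2 * e > 4]: a speed of at least [sqrt e] during time [T] moves [v] by more
     than 2. *)
  set (T := 2 + 2 / e).
  assert (hT : 2 < T) by (unfold T; assert (0 < 2 / e) by (apply Rdiv_lt_0_compat; lra); lra).
  assert (hTe : T * e = 2 * e + 2) by (unfold T; field; lra).
  destruct (MVT_gen v 0 T w) as [s [_ hs]].
  - intros; apply h.
  - intros x _; apply continuity_pt_filterlim, (phase_ode_continuous v w h).
  - assert (He := energy v w h s t); fold e in He.
    assert (B0 := phase_ode_bounded v w h 0); assert (BT := phase_ode_bounded v w h T).
    assert (hw : e <= w s ^ 2) by (assert (A := pow2_ge_0 (1 - v s ^ 2)); lra).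
    assert (-2 <= w s * T <= 2) by (replace (T - 0) with T in hs by ring; lra).
    assert ((w s * T) ^ 2 <= 4) by nra.
    assert (T * (T * e) <= T * (T * w s ^ 2)) by (repeat apply Rmult_le_compat_l; lra).
    nra.
Qed.

(** * Zero energy: the Riccati equation and the kinks *)

Lemma energy_zero_monotone v w :
  phase_ode v w -> w 0 ^ 2 = (1 - v 0 ^ 2) ^ 2 ->
  exists s, (s = 1 \/ s = -1) /\ forall t, w t = s * (1 - v t ^ 2).
Proof.
  intros h h0.
  assert (H : (w 0 - (1 - v 0 ^ 2)) * (w 0 + (1 - v 0 ^ 2)) = 0) by nra.
  (* A factor that vanishes at time 0 vanishes at all times. *)
  apply Rmult_integral in H; destruct H as [H | H].
  - exists 1; split; auto; intros t.
    assert (P := left_factor v w h 0 t); rewrite H in P; lra.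
  - exists (-1); split; auto; intros t.
    assert (P := right_factor v w h 0 t); rewrite H in P; lra.
Qed.

(* With [v' = 1 - v^2], both [(1 + v) e^(-t)] and [(1 - v) e^t] solve [f' = - v f]. *)
Lemma riccati_kink (v : R -> R) :
  (forall t, is_derive v t (1 - v t ^ 2)) -> forall t,
  (1 - v 0) * (1 + v t) = (1 + v 0) * (1 - v t) * exp t ^ 2.
Proof.
  intros dv t.
  assert (hc : forall s, continuous (fun s => - v s) s).
  { intros s; apply (continuous_opp v).
    apply (@ex_derive_continuous R_AbsRing R_NormedModule); eexists; apply dv. }
  assert (H1 := linear_ode (fun t => (1 + v t) * exp (- t)) (fun s => - v s) hc).
  assert (H2 := linear_ode (fun t => (1 - v t) * exp t) (fun s => - v s) hc).
  assert (E1 : (1 + v t) * exp (- t) = (1 + v 0) * exp (- 0) * exp (RInt (fun s => - v s) 0 t)).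
  { apply H1; intros s; specialize (dv s); auto_derive; [eexists; eassumption|].
    rewrite (is_derive_unique (fun x : R => v x) s _ dv); ring. }
  assert (E2 : (1 - v t) * exp t = (1 - v 0) * exp 0 * exp (RInt (fun s => - v s) 0 t)).
  { apply H2; intros s; specialize (dv s); auto_derive; [eexists; eassumption|].
    rewrite (is_derive_unique (fun x : R => v x) s _ dv); ring. }
  rewrite Ropp_0, exp_0, Rmult_1_r in *.
  set (m := exp (RInt (fun s => - v s) 0 t)) in *.
  assert (hm : m > 0) by apply exp_pos.
  assert (ht : exp (- t) * exp t = 1) by (rewrite <- exp_plus, Rplus_opp_l; apply exp_0).
  assert (E3 : (1 + v t) = (1 + v 0) * m * exp t) by (rewrite <- E1, Rmult_assoc, ht; ring).
  rewrite E3.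
  transitivity ((1 + v 0) * exp t * ((1 - v 0) * m)); [ring | rewrite <- E2; ring].
Qed.

(** * The angular variable: speed and elapsed time *)

Definition speed (M x : R) : R := sqrt (2 - M ^ 2 - (M * sin x) ^ 2).

(** The time in which the angle runs from 0 to [x]. Up to the factor [1 / sqrt (2 - M^2)] it is the
    incomplete elliptic integral of the first kind with [k^2 = M^2 / (2 - M^2)]. *)
Definition elapsed (M x : R) : R := RInt (fun s => / speed M s) 0 x.

Lemma speed_arg_bounds M x :
  0 < M < 1 -> 0 < 2 - M ^ 2 - (M * sin x) ^ 2 <= 2.
Proof.
  intros hM; assert (B := SIN_bound x); split; [| nra].
  assert (sin x ^ 2 <= 1) by nra.
  assert (M ^ 2 * sin x ^ 2 <= M ^ 2 * 1) by (apply Rmult_le_compat_l; nra); nra.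
Qed.

Lemma speed_pos M x : 0 < M < 1 -> 0 < speed M x.
Proof. intros hM; apply sqrt_lt_R0, speed_arg_bounds, hM. Qed.

Lemma speed_le M x : 0 < M < 1 -> speed M x <= 2.
Proof.
  intros hM; assert (B := speed_arg_bounds M x hM).
  apply Rle_trans with (sqrt (2 ^ 2)); [apply sqrt_le_1; lra | rewrite sqrt_pow2; lra].
Qed.

Lemma elapsed_derive M x : 0 < M < 1 -> is_derive (elapsed M) x (/ speed M x).
Proof.
  intros hM; apply (RInt_derive (fun s => / speed M s)); intros s.
  apply (@ex_derive_continuous R_AbsRing R_NormedModule).
  assert (B := speed_arg_bounds M s hM); unfold speed.
  auto_derive; split; [| split; [apply Rgt_not_eq, sqrt_lt_R0 | exact I]]; simpl in *; lra.
Qed.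

(** The bound [speed <= 2] gives slope at least [/ 2]; order reflection and injectivity of
    [elapsed M] follow. *)
Lemma elapsed_growth M x y : 0 < M < 1 -> x <= y -> / 2 * (y - x) <= elapsed M y - elapsed M x.
Proof.
  intros hM hxy; apply (derive_lower_bound _ (fun s => / speed M s)); auto; intros t _.
  - apply elapsed_derive, hM.
  - apply Rinv_le_contravar; [apply speed_pos | apply speed_le]; auto.
Qed.

Lemma elapsed_lt M x y : 0 < M < 1 -> elapsed M x < elapsed M y -> x < y.
Proof.
  intros hM h; apply Rnot_le_lt; intros hyx.
  assert (G := elapsed_growth M y x hM hyx); lra.
Qed.

Lemma elapsed_inj M x y : 0 < M < 1 -> elapsed M x = elapsed M y -> x = y.
Proof.
  intros hM h; destruct (Rtotal_order x y) as [H | [H | H]]; auto.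
  - assert (G := elapsed_growth M x y hM); lra.
  - assert (G := elapsed_growth M y x hM); lra.
Qed.

(** [speed] depends on the angle only through [sin^2], which has period [PI]. *)
Lemma elapsed_shift M x : 0 < M < 1 -> elapsed M (x + PI) = elapsed M x + elapsed M PI.
Proof.
  intros hM.
  assert (E : elapsed M (x + PI) - elapsed M x = elapsed M (0 + PI) - elapsed M 0).
  { apply (derive_zero_const (fun x => elapsed M (x + PI) - elapsed M x)); intros t.
    assert (D1 := elapsed_derive M t hM); assert (D2 := elapsed_derive M (t + PI) hM).
    auto_derive; [repeat split; eexists; eassumption |].
    rewrite (is_derive_unique (fun x : R => elapsed M x) _ _ D1),
      (is_derive_unique (fun x : R => elapsed M x) _ _ D2).
    unfold speed; rewrite neg_sin.
    replace ((M * - sin t) ^ 2) with ((M * sin t) ^ 2) by ring; ring. }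
  replace (elapsed M 0) with 0 in E by (symmetry; apply (RInt_point (V := R_CompleteNormedModule))).
  rewrite Rplus_0_l in E; lra.
Qed.

(** * Oscillating solutions: angle, extrema, translation and smallest period *)

Lemma circle_angle x y : x ^ 2 + y ^ 2 = 1 -> exists a, x = sin a /\ y = cos a.
Proof.
  intros h; assert (hx : -1 <= x <= 1) by nra.
  assert (hs : sqrt (1 - Rsqr x) = Rabs y).
  { rewrite <- sqrt_Rsqr_abs; f_equal; unfold Rsqr; lra. }
  destruct (Rle_or_lt 0 y) as [hy | hy].
  - exists (asin x); rewrite sin_asin, cos_asin, hs, Rabs_pos_eq; auto.
  (* [asin] reaches only angles with nonnegative cosine; reflection in the vertical axis covers the
     others. *)
  - exists (PI - asin x); rewrite sin_PI_x, sin_asin; auto; split; auto.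
    rewrite Rtrigo_facts.cos_pi_minus, cos_asin, hs, Rabs_left; auto; ring.
Qed.

(** The separated form of [phi' = speed M phi]: an implicit equation for the angle, with phase [C],
    from which period and translation follow without differentiation. *)
Definition oscillation (M : R) (v phi : R -> R) (C : R) : Prop :=
  forall t, v t = M * sin (phi t) /\ elapsed M (phi t) = t + C.

(* Both [(v, w / G)] and [M (sin phi, cos phi)] rotate at angular speed [G], starting from the same point. *)
Lemma phase_ode_oscillation v w M :
  phase_ode v w -> 0 < M < 1 ->
  (forall t, w t ^ 2 = (1 - v t ^ 2) ^ 2 - (1 - M ^ 2) ^ 2) ->
  exists phi C, oscillation M v phi C.
Proof.
  intros h hM he.
  assert (hb := phase_ode_bounded v w h).
  assert (hA : forall t, 0 < 2 - M ^ 2 - v t ^ 2) by (intros t; specialize (hb t); nra).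
  (* The angular speed expressed through [v], before the angle is available. *)
  set (G := fun t => sqrt (2 - M ^ 2 - v t ^ 2)).
  assert (hG : forall t, 0 < G t) by (intros t; apply sqrt_lt_R0, hA).
  assert (hG2 : forall t, G t ^ 2 = 2 - M ^ 2 - v t ^ 2).
  { intros t; apply pow2_sqrt; specialize (hA t); lra. }
  (* The energy relation factors as [w^2 = (2 - M^2 - v^2) * (M^2 - v^2)], and the first factor is
     [G^2]. *)
  assert (hc : forall t, v t ^ 2 + (w t / G t) ^ 2 = M ^ 2).
  { intros t; specialize (hG t); replace ((w t / G t) ^ 2) with (w t ^ 2 / G t ^ 2) by (field; lra).
    rewrite he, hG2; specialize (hA t); field; lra. }
  destruct (circle_angle (v 0 / M) (w 0 / G 0 / M)) as [a [ha1 ha2]].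
  { replace ((v 0 / M) ^ 2 + (w 0 / G 0 / M) ^ 2)
      with ((v 0 ^ 2 + (w 0 / G 0) ^ 2) / M ^ 2) by (field; specialize (hG 0); lra).
    rewrite hc; field; lra. }
  assert (hGc : forall t, continuous G t).
  { intros t; apply (@ex_derive_continuous R_AbsRing R_NormedModule).
    destruct (h t) as [dv _]; specialize (hA t); unfold G.
    auto_derive; repeat split; [eexists; eassumption | simpl in *; lra]. }
  set (phi := fun t => a + RInt G 0 t).
  assert (dphi : forall t, is_derive phi t (G t)).
  { intros t; evar_last.
    - apply (is_derive_plus (fun _ => a) (fun t => RInt G 0 t));
        [apply is_derive_const | apply RInt_derive, hGc].
    - apply (plus_zero_l (G t)). }
  assert (hv : forall t, v t = M * sin (phi t)).
  (* [D] is the squared distance between the two rotating points: it is constant and starts at 0. *)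
  { set (D := fun t => (v t - M * sin (phi t)) ^ 2 + (w t / G t - M * cos (phi t)) ^ 2).
    assert (hD : forall t, D t = 0).
    { intros t; replace 0 with (D 0).
      2: { unfold D, phi; rewrite RInt_point; change (@zero _) with 0.
           rewrite Rplus_0_r, <- ha1, <- ha2; field; specialize (hG 0); lra. }
      apply derive_zero_const; clear t; intros t; unfold D.
      assert (dc : is_derive (fun t => w t / G t) t (- v t * G t)).
      { destruct (h t) as [dv dw]; specialize (hA t); specialize (hG t); unfold G in *.
        auto_derive;
          replace (2 - M * (M * 1) + - (v t * (v t * 1))) with (2 - M ^ 2 - v t ^ 2) by ring;
          [repeat split; try (eexists; eassumption); lra |].
        rewrite (is_derive_unique (fun x : R => v x) _ _ dv),
          (is_derive_unique (fun x : R => w x) _ _ dw).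
        assert (E := hG2 t); unfold G in E; specialize (he t).
        set (g := sqrt (2 - M ^ 2 - v t ^ 2)) in *.
        apply Rmult_eq_reg_r with (g ^ 3); [| apply pow_nonzero; lra].
        transitivity (- 2 * v t * (1 - v t ^ 2) * g ^ 2 + v t * w t ^ 2); [field; lra |].
        transitivity (- v t * (g ^ 2) ^ 2); [| ring].
        rewrite E, he; ring. }
      destruct (h t) as [dv _]; specialize (dphi t).
      set (c := fun t => w t / G t) in *.
      change (is_derive (fun t => (v t - M * sin (phi t)) ^ 2 + (c t - M * cos (phi t)) ^ 2) t 0).
      auto_derive; [repeat split; eexists; eassumption |].
      rewrite (is_derive_unique (fun x : R => v x) _ _ dv),
          (is_derive_unique (fun x : R => c x) _ _ dc),
          (is_derive_unique (fun x : R => phi x) _ _ dphi).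
      replace (w t) with (c t * G t) by (unfold c; field; specialize (hG t); lra).
      ring. }
    intros t; specialize (hD t); unfold D in hD.
    assert (A1 := pow2_ge_0 (v t - M * sin (phi t))).
    assert (A2 := pow2_ge_0 (w t / G t - M * cos (phi t))).
    assert (hz : (v t - M * sin (phi t)) ^ 2 = 0) by lra.
    rewrite <- Rsqr_pow2 in hz; apply Rsqr_0_uniq in hz; lra. }
  exists phi, (elapsed M (phi 0)); intros t; split; [apply hv |].
  assert (E : elapsed M (phi t) - t = elapsed M (phi 0) - 0).
  { apply (derive_zero_const (fun t => elapsed M (phi t) - t)); intros s.
    assert (D1 := elapsed_derive M (phi s) hM); specialize (dphi s).
    auto_derive; [repeat split; eexists; eassumption |].
    rewrite (is_derive_unique (fun x : R => elapsed M x) _ _ D1),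
      (is_derive_unique (fun x : R => phi x) _ _ dphi).
    unfold speed; rewrite <- hv; fold (G s); specialize (hG s); field; lra. }
  lra.
Qed.

(** Exhibits a time at which the angle takes a prescribed value, so that the extrema of [sin] are
    attained. *)
Lemma oscillation_at M v phi C x :
  0 < M < 1 -> oscillation M v phi C -> phi (elapsed M x - C) = x.
Proof.
  intros hM h; apply (elapsed_inj M); auto.
  rewrite (proj2 (h _)); ring.
Qed.

Lemma oscillation_max M v phi C : 0 < M < 1 -> oscillation M v phi C -> has_max v M.
Proof.
  intros hM h; split.
  - exists (elapsed M (PI / 2) - C).
    rewrite (proj1 (h _)), (oscillation_at M v), sin_PI2; auto; ring.
  - intros t; rewrite (proj1 (h t)); assert (B := SIN_bound (phi t)); nra.
Qed.

Lemma oscillation_min M v phi C : 0 < M < 1 -> oscillation M v phi C -> has_min v (- M).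
Proof.
  intros hM h; split.
  - exists (elapsed M (- (PI / 2)) - C).
    rewrite (proj1 (h _)), (oscillation_at M v), sin_neg, sin_PI2; auto; ring.
  - intros t; rewrite (proj1 (h t)); assert (B := SIN_bound (phi t)); nra.
Qed.

(** The implicit equations for the two angles differ only in the constant, and [elapsed M] is
    injective. *)
Lemma oscillation_translate M v phi C v' phi' C' :
  0 < M < 1 -> oscillation M v phi C -> oscillation M v' phi' C' ->
  forall t, v' t = v (t + (C' - C)).
Proof.
  intros hM h h' t; rewrite (proj1 (h _)), (proj1 (h' t)); do 2 f_equal.
  apply (elapsed_inj M); auto; rewrite (proj2 (h _)), (proj2 (h' t)); ring.
Qed.

(** A period is the time of a full turn, and by [elapsed_shift] both half turns take the same
    time. *)
Lemma oscillation_period M v phi C :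
  0 < M < 1 -> oscillation M v phi C -> smallest_period v (2 * elapsed M PI).
Proof.
  intros hM h.
  assert (h2 : forall x, elapsed M (x + PI + PI) = elapsed M x + 2 * elapsed M PI).
  { intros x; rewrite !elapsed_shift; auto; ring. }
  assert (hpos : 0 < elapsed M PI).
  { assert (A := elapsed_growth M 0 PI hM); assert (P := PI_RGT_0).
    replace (elapsed M 0) with 0 in A
      by (symmetry; apply (RInt_point (V := R_CompleteNormedModule))); lra. }
  split; [split; [lra |] |].
  - intros t; rewrite (proj1 (h _)), (proj1 (h t)).
    replace (phi (t + 2 * elapsed M PI)) with (phi t + PI + PI); [rewrite !neg_sin; ring |].
    apply (elapsed_inj M); auto; rewrite h2, !(fun s => proj2 (h s)); ring.
  - intros T [hT hper]; apply Rnot_lt_le; intros hlt.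
    (* Minimality is tested at a maximum of [v]: strictly within the next full turn [sin] does not
       return to 1. *)
    set (t := elapsed M (PI / 2) - C).
    assert (ht : phi t = PI / 2) by (apply (oscillation_at M v); auto).
    specialize (hper t); rewrite (proj1 (h _)), (proj1 (h t)), ht in hper.
    apply Rmult_eq_reg_l in hper; [| lra].
    assert (hF : elapsed M (phi (t + T)) = elapsed M (PI / 2) + T).
    { rewrite (proj2 (h _)); unfold t; ring. }
    assert (h0 : PI / 2 < phi (t + T)) by (apply (elapsed_lt M); auto; lra).
    assert (h1 : phi (t + T) < PI / 2 + PI + PI) by (apply (elapsed_lt M); auto; rewrite h2; lra).
    (* Half the angle gained, in [(0, PI)]; [sin (PI / 2 + 2 * y) = 1 - 2 * sin y ^ 2] would force
       [sin y = 0]. *)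
    set (y := (phi (t + T) - PI / 2) / 2) in *.
    replace (phi (t + T)) with (PI / 2 + 2 * y) in hper by (unfold y; field).
    rewrite <- cos_sin, sin_PI2, cos_2a_sin in hper.
    assert (0 < sin y) by (apply sin_gt_0; unfold y; lra); nra.
Qed.

(** * The half period as an improper integral *)

Lemma asin_left_limit eps :
  0 < eps -> exists d, 0 < d /\ forall x, 1 - d < x < 1 -> Rabs (asin x - PI / 2) < eps.
Proof.
  intros he; assert (P := PI_RGT_0).
  (* The cap at [PI / 2] keeps [PI / 2 - e] in the range where [sin] is increasing. *)
  set (e := Rmin eps (PI / 2)).
  assert (h1 : 0 < e) by (apply Rmin_pos; lra).
  assert (h2 := Rmin_l eps (PI / 2)); assert (h3 := Rmin_r eps (PI / 2)); fold e in h2, h3.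
  exists (1 - sin (PI / 2 - e)); split.
  - rewrite <- sin_PI2 at 1; assert (A := sin_increasing_1 (PI / 2 - e) (PI / 2)); lra.
  - intros x hx; assert (hx0 := SIN_bound (PI / 2 - e)).
    assert (B := asin_bound x).
    assert (PI / 2 - e < asin x).
    { apply sin_increasing_0; try lra; rewrite sin_asin; lra. }
    rewrite Rabs_left1; lra.
Qed.

(** The substitution [theta = M sin phi]: the derivative of [asin] supplies the factor
    [sqrt (M^2 - theta^2)], and [speed] the other one. *)
Lemma elapsed_asin_derive M x :
  0 < M < 1 -> - M < x < M ->
  is_derive (fun x => elapsed M (asin (x / M))) x (period_integrand M x).
Proof.
  intros hM hx.
  assert (hxM : -1 < x / M < 1).
  { split; apply Rmult_lt_reg_r with M; try lra; unfold Rdiv; rewrite Rmult_assoc, Rinv_l; lra. }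
  assert (D1 : is_derive asin (x / M) (1 / sqrt (1 - (x / M) ^ 2))).
  { apply is_derive_Reals; rewrite <- Rsqr_pow2.
    apply (derive_pt_eq_1 _ _ _ (derivable_pt_asin _ hxM)), derive_pt_asin. }
  assert (D2 := elapsed_derive M (asin (x / M)) hM).
  auto_derive; [repeat split; eexists; eassumption |].
  change (x * / M) with (x / M).
  rewrite (is_derive_unique (fun x : R => asin x) _ _ D1),
    (is_derive_unique (fun x : R => elapsed M x) _ _ D2).
  unfold speed, period_integrand; rewrite sin_asin by lra.
  replace (M * (x / M)) with x by (field; lra).
  assert (0 < 2 - M ^ 2 - x ^ 2) by nra.
  assert (0 < 1 - (x / M) ^ 2) by nra.
  replace (M ^ 2 - x ^ 2) with (M ^ 2 * (1 - (x / M) ^ 2)) by (field; lra).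
  rewrite !sqrt_mult, sqrt_pow2 by nra.
  assert (A1 := sqrt_lt_R0 (2 - M ^ 2 - x ^ 2)); assert (A2 := sqrt_lt_R0 (1 - (x / M) ^ 2)).
  field; lra.
Qed.

(** The integrand is singular at both ends, but its antiderivative [H] has limits there, with angles
    [- (PI / 2)] and [PI / 2]. *)
Lemma period_integral M :
  0 < M < 1 ->
  is_RInt_gen (period_integrand M) (at_right (- M)) (at_left M) (elapsed M PI).
Proof.
  intros hM; assert (hpi := PI_RGT_0).
  set (H := fun x => elapsed M (asin (x / M))).
  assert (hF : forall x, filterlim (elapsed M) (locally x) (locally (elapsed M x))).
  { intros x; apply (@ex_derive_continuous R_AbsRing R_NormedModule).
    eexists; apply elapsed_derive, hM. }
  assert (hL : filterlim H (at_left M) (locally (elapsed M (PI / 2)))).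
  { apply (filterlim_comp _ _ _ (fun x => asin (x / M)) (elapsed M) _ (locally (PI / 2)));
      [| apply hF].
    apply filterlim_locally; intros [eps he].
    destruct (asin_left_limit eps he) as [d [hd h]].
    assert (hdM : 0 < d * M) by nra.
    exists (mkposreal _ hdM); intros y hy hyM; apply h.
    apply Rabs_def2 in hy; unfold minus, plus, opp in hy; simpl in hy.
    split; apply Rmult_lt_reg_r with M; try lra;
      unfold Rdiv; rewrite (Rmult_assoc y), Rinv_l; lra. }
  assert (hR : filterlim H (at_right (- M)) (locally (elapsed M (- (PI / 2))))).
  { apply (filterlim_comp _ _ _ (fun x => asin (x / M)) (elapsed M) _ (locally (- (PI / 2))));
      [| apply hF].
    apply filterlim_locally; intros [eps he].
    destruct (asin_left_limit eps he) as [d [hd h]].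
    assert (hdM : 0 < d * M) by nra.
    exists (mkposreal _ hdM); intros y hy hyM.
    apply Rabs_def2 in hy; unfold minus, plus, opp in hy; simpl in hy.
    (* Oddness of [asin] reduces this end to the other one. *)
    assert (A : Rabs (asin (- (y / M)) - PI / 2) < eps).
    { apply h; split; apply Rmult_lt_reg_r with M; try lra;
        unfold Rdiv; rewrite <- Ropp_mult_distr_l, (Rmult_assoc y), Rinv_l; lra. }
    rewrite asin_opp, <- Rabs_Ropp in A.
    change (Rabs (asin (y / M) - - (PI / 2)) < eps).
    replace (asin (y / M) - - (PI / 2)) with (- (- asin (y / M) - PI / 2)) by ring; auto. }
  assert (hI : elapsed M PI = elapsed M (PI / 2) - elapsed M (- (PI / 2))).
  { replace (PI / 2) with (- (PI / 2) + PI) at 1 by field; rewrite elapsed_shift; auto; ring. }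
  rewrite hI.
  intros P [eps hP].
  assert (he : 0 < eps / 2) by (destruct eps; simpl; lra).
  assert (hL' := proj1 (filterlim_locally H _) hL (mkposreal _ he)).
  assert (hR' := proj1 (filterlim_locally H _) hR (mkposreal _ he)).
  assert (hM0 : 0 < M) by lra.
  (* The signs of [a] and [b] put [[a, b]] inside [(- M, M)]; the two half-[eps] errors add up to
     [eps]. *)
  apply (Filter_prod _ _ _
    (fun a => (- M < a < 0) /\ ball (elapsed M (- (PI / 2))) (eps / 2) (H a))
    (fun b => (0 < b < M) /\ ball (elapsed M (PI / 2)) (eps / 2) (H b))).
  - apply filter_and; [| exact hR'].
    exists (mkposreal _ hM0); intros y hy hyM.
    apply Rabs_def2 in hy; unfold minus, plus, opp in hy; simpl in hy; lra.
  - apply filter_and; [| exact hL'].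
    exists (mkposreal _ hM0); intros y hy hyM.
    apply Rabs_def2 in hy; unfold minus, plus, opp in hy; simpl in hy; lra.
  - intros a b [ha hHa] [hb hHb]; exists (H b - H a); split.
    + apply (is_RInt_derive H (period_integrand M)); simpl;
        rewrite Rmin_left, Rmax_right by lra; intros x hx.
      * apply elapsed_asin_derive; lra.
      * apply (@ex_derive_continuous R_AbsRing R_NormedModule); unfold period_integrand.
        assert (0 < (2 - M ^ 2 - x ^ 2) * (M ^ 2 - x ^ 2)) by (apply Rmult_lt_0_compat; nra).
        auto_derive; split; [| split; [apply Rgt_not_eq, sqrt_lt_R0 | exact I]]; simpl in *; lra.
    + apply hP; apply Rabs_def2 in hHa; apply Rabs_def2 in hHb; apply Rabs_def1;
        unfold minus, plus, opp in *; simpl in *; lra.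
Qed.

(** * Reduction of the radial equation to the system in logarithmic time *)

Lemma enorm_axis r : 0 < r -> enorm r 0 = r.
Proof.
  intros hr; unfold enorm; replace (r ^ 2 + 0 ^ 2) with (r ^ 2) by ring; apply sqrt_pow2; lra.
Qed.

Lemma enorm_pos x y : (x, y) <> (0, 0) -> 0 < enorm x y.
Proof.
  intros h; apply sqrt_lt_R0.
  destruct (Req_dec x 0) as [-> | hx]; [| nra].
  destruct (Req_dec y 0) as [-> | hy]; [congruence | nra].
Qed.

Lemma radial_axis u x y : radial u -> (x, y) <> (0, 0) -> u x y = u (enorm x y) 0.
Proof.
  intros hu h; assert (P := enorm_pos x y h).
  apply hu; auto; [| rewrite enorm_axis; auto].
  intros E; injection E; lra.
Qed.

Lemma axis_nonzero r y : 0 < r -> (r, y) <> (0, 0).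
Proof. intros hr E; injection E; lra. Qed.

(** On the positive horizontal axis [u_xx = U''] and [u_yy = U' / r]; multiplied by [r^2], their sum
    is the second derivative of [U (exp t)] in [t]. *)
Lemma radial_solution_phase_ode u :
  radial_solution u ->
  phase_ode (log_profile u) (fun t => exp t * Derive (fun r => u r 0) (exp t)).
Proof.
  intros [hC [hrad heq]].
  set (U := fun r => u r 0).
  assert (d1 : forall r, 0 < r -> ex_derive U r).
  { intros r hr; apply (hC r 0 (axis_nonzero r 0 hr)). }
  assert (d2 : forall r, 0 < r -> ex_derive (Derive U) r).
  { intros r hr; destruct (hC r 0 (axis_nonzero r 0 hr)) as [_ [_ [_ [H _]]]].
    destruct H as [_ [H _]]; exact H. }
  assert (hode : forall r, 0 < r ->
    r ^ 2 * Derive (Derive U) r + r * Derive U r = - (2 * U r * (1 - U r ^ 2))).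
  { intros r hr.
    (* The first derivative in [y] is computed for every [y], since it is differentiated again at
       0. *)
    assert (hpos : forall y, 0 < r ^ 2 + y ^ 2) by (intros y; nra).
    assert (hy : forall y, Derive (fun z => u r z) y
      = y / sqrt (r ^ 2 + y ^ 2) * Derive U (sqrt (r ^ 2 + y ^ 2))).
    { intros y.
      rewrite (Derive_ext _ (fun z => U (sqrt (r ^ 2 + z ^ 2)))).
      2: { intros z; apply (radial_axis u r z hrad), axis_nonzero, hr. }
      specialize (hpos y); assert (hs := sqrt_lt_R0 _ hpos).
      apply is_derive_unique; auto_derive.
      - simpl in *; repeat split; auto.
      - replace (r * (r * 1) + y * (y * 1)) with (r ^ 2 + y ^ 2) by ring.
        change (Derive (fun x : R => U x)) with (Derive U); field; lra. }
    assert (h2 : partial_derive 0 2 u r 0 = Derive U r / r).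
    { change (Derive (fun y => Derive (fun z => u r z) y) 0 = Derive U r / r).
      rewrite (Derive_ext _ _ _ hy).
      assert (hs : sqrt (r ^ 2 + 0 ^ 2) = r) by (apply (enorm_axis r hr)).
      specialize (hpos 0).
      apply is_derive_unique; auto_derive.
      - replace (r * (r * 1) + 0 * (0 * 1)) with (r ^ 2 + 0 ^ 2) by ring; rewrite hs.
        repeat split; auto; lra.
      - replace (r * (r * 1) + 0 * (0 * 1)) with (r ^ 2 + 0 ^ 2) by ring; rewrite hs.
        change (Derive (fun x : R => U x)) with (Derive U); field; lra. }
    assert (E := heq r 0 (axis_nonzero r 0 hr)).
    unfold laplacian in E; rewrite h2, enorm_axis in E by auto.
    change (partial_derive 2 0 u r 0) with (Derive (Derive U) r) in E.
    change (u r 0) with (U r) in E.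
    transitivity (- r ^ 2 * - (Derive (Derive U) r + Derive U r / r)); [field; lra |].
    rewrite E; field; lra. }
  intros t; assert (hr := exp_pos t).
  change (log_profile u) with (fun t => U (exp t)).
  change (Derive (fun r => u r 0)) with (Derive U).
  split; auto_derive; auto; change (Derive (fun x : R => U x)) with (Derive U).
  - ring.
  - change (Derive (fun x : R => Derive U x)) with (Derive (Derive U)).
    rewrite <- hode by auto; ring.
Qed.

Lemma limit_at_origin_iff u l :
  radial u ->
  limit_at_origin u l <->
  forall eps, 0 < eps -> exists d, 0 < d /\ forall r, 0 < r < d -> Rabs (u r 0 - l) < eps.
Proof.
  intros hrad; unfold limit_at_origin; rewrite filterlim_locally; split.
  - intros h eps he; destruct (h (mkposreal eps he)) as [[d hd] H].
    exists d; split; auto; intros r hr.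
    apply (H (r, 0)); [split; simpl | apply axis_nonzero, hr].
    + apply Rabs_def1; unfold minus, plus, opp; simpl; lra.
    + apply (@ball_center R_UniformSpace 0 (mkposreal d hd)).
  - intros h [eps he]; destruct (h eps he) as [d [hd H]].
    (* Balls of the product are squares; half the side keeps the Euclidean norm below [d]. *)
    assert (hd2 : 0 < d / 2) by lra.
    exists (mkposreal _ hd2); intros [x y] [hx hy] hne; simpl in *.
    change (Rabs (u x y - l) < eps).
    rewrite (radial_axis u x y hrad hne); apply H; split; [apply enorm_pos, hne |].
    apply Rabs_def2 in hx; apply Rabs_def2 in hy; unfold minus, plus, opp in *; simpl in *.
    unfold enorm; rewrite <- (sqrt_pow2 d) by lra; apply sqrt_lt_1; nra.
Qed.

(** * Classification of the profiles by energy *)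

Lemma kink_enorm a x y : kink a x y = kink a (enorm x y) 0.
Proof.
  unfold kink; replace (enorm (enorm x y) 0) with (enorm x y); auto.
  unfold enorm at 2; replace (enorm x y ^ 2 + 0 ^ 2) with (enorm x y ^ 2) by ring.
  symmetry; apply sqrt_pow2, sqrt_pos.
Qed.

Lemma riccati_kink_form (v : R -> R) :
  (forall t, is_derive v t (1 - v t ^ 2)) -> (forall t, -1 <= v t <= 1) ->
  exists a sgn, (sgn = 1 \/ sgn = -1) /\ forall t, v t = sgn * kink a (exp t) 0.
Proof.
  intros dv hb; assert (hk := riccati_kink v dv); assert (B0 := hb 0).
  destruct (Req_dec (v 0) 1) as [h1 | h1]; [| destruct (Req_dec (v 0) (-1)) as [h2 | h2]].
  (* The constant 1 is minus the degenerate kink, which is -1 by convention. *)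
  - exists 0, (-1); split; auto; intros t.
    unfold kink; destruct (Req_EM_T 0 0); [| lra].
    assert (P := pow_lt (exp t) 2 (exp_pos t)); specialize (hk t); rewrite h1 in hk.
    nra.
  - exists 0, 1; split; auto; intros t.
    unfold kink; destruct (Req_EM_T 0 0); [| lra].
    specialize (hk t); rewrite h2 in hk; lra.
  - assert (hq : 0 < (1 - v 0) / (1 + v 0)) by (apply Rdiv_lt_0_compat; lra).
    (* Solving the relation of [riccati_kink] for [v t] gives [a^2 = (1 - v 0) / (1 + v 0)]. *)
    exists (sqrt ((1 - v 0) / (1 + v 0))), (-1); split; auto; intros t.
    assert (hs := sqrt_lt_R0 _ hq).
    unfold kink; destruct (Req_EM_T (sqrt ((1 - v 0) / (1 + v 0))) 0); [lra |].
    rewrite pow2_sqrt, enorm_axis by (lra || apply exp_pos).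
    assert (P := pow_lt (exp t) 2 (exp_pos t)); specialize (hk t).
    set (r := exp t ^ 2) in *.
    assert (0 < (1 - v 0) + (1 + v 0) * r) by nra.
    apply Rmult_eq_reg_r with ((1 - v 0) + (1 + v 0) * r); [| lra].
    transitivity ((1 + v 0) * r - (1 - v 0)); [nra | field; lra].
Qed.

Lemma phase_ode_classification v w :
  phase_ode v w ->
  (forall t, v t = 0) \/
  (exists a sgn, (sgn = 1 \/ sgn = -1) /\ forall t, v t = sgn * kink a (exp t) 0) \/
  (exists M phi C, 0 < M < 1 /\ oscillation M v phi C).
Proof.
  intros h; assert (hb := phase_ode_bounded v w h).
  set (e := (1 - v 0 ^ 2) ^ 2 - w 0 ^ 2).
  assert (he : forall t, w t ^ 2 = (1 - v t ^ 2) ^ 2 - e).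
  { intros t; assert (E := energy v w h t 0); unfold e; lra. }
  assert (he0 : 0 <= e) by (assert (E := energy_nonpos v w h 0); unfold e; lra).
  destruct (Req_dec e 0) as [hz | hz].
  - right; left.
    destruct (energy_zero_monotone v w h) as [s [hs hw]]; [rewrite he; lra |].
    destruct hs as [-> | ->].
    + apply riccati_kink_form; auto.
      intros t; replace (1 - v t ^ 2) with (w t) by (rewrite hw; ring); apply h.
    + destruct (riccati_kink_form (fun t => - v t)) as [a [sgn [hsgn hv]]].
      * intros t; replace (1 - (- v t) ^ 2) with (- w t) by (rewrite hw; ring).
        apply (phase_ode_opp v w h).
      * intros t; specialize (hb t); lra.
      * exists a, (- sgn); split; [lra |]; intros t; specialize (hv t); lra.
  - assert (hy : forall t, 0 <= v t ^ 2 <= 1) by (intros t; specialize (hb t); nra).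
    assert (hw : forall t, e <= (1 - v t ^ 2) ^ 2).
    { intros t; specialize (he t); assert (A := pow2_ge_0 (w t)); lra. }
    (* From [e <= (1 - v^2)^2 <= 1], the value [e >= 1] leaves only [v = 0]. *)
    destruct (Rle_or_lt 1 e) as [h1 | h1].
    + left; intros t; specialize (hw t); specialize (hy t).
      assert (hv : v t ^ 2 = 0) by nra.
      rewrite <- Rsqr_pow2 in hv; apply Rsqr_0_uniq, hv.
    + right; right.
      assert (hq0 : 0 < sqrt e) by (apply sqrt_lt_R0; lra).
      assert (hq : sqrt e ^ 2 = e) by (apply pow2_sqrt, he0).
      assert (hq1 : sqrt e < 1) by nra.
      assert (hM : sqrt (1 - sqrt e) ^ 2 = 1 - sqrt e) by (apply pow2_sqrt; lra).
      assert (hM0 : 0 < sqrt (1 - sqrt e)) by (apply sqrt_lt_R0; lra).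
      (* The solution in [(0, 1)] of [(1 - M^2)^2 = e]. *)
      set (M := sqrt (1 - sqrt e)) in *.
      assert (hM1 : 0 < M < 1) by nra.
      destruct (phase_ode_oscillation v w M h hM1) as [phi [C ho]].
      * intros t; rewrite he, hM; f_equal; rewrite <- hq at 1; ring.
      * exists M, phi, C; auto.
Qed.

(** * Behaviour at the origin of each type of profile *)

Lemma kink_limit a :
  forall eps, 0 < eps ->
  exists d, 0 < d /\ forall r, 0 < r < d -> Rabs (kink a r 0 - kink a 0 0) < eps.
Proof.
  intros eps he; unfold kink; destruct (Req_EM_T a 0) as [ha | ha].
  - exists 1; split; [lra |]; intros r _; rewrite Rminus_diag, Rabs_R0; auto.
  - assert (hc : continuous (fun r => (a ^ 2 - r ^ 2) / (a ^ 2 + r ^ 2)) 0).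
    { apply (@ex_derive_continuous R_AbsRing R_NormedModule); auto_derive.
      assert (P := pow2_gt_0 a ha); simpl in *; lra. }
    assert (H := proj1 (filterlim_locally _ _) hc (mkposreal eps he)).
    destruct H as [[d hd] H]; exists d; split; auto; intros r hr.
    replace (enorm 0 0) with 0
      by (unfold enorm; replace (0 ^ 2 + 0 ^ 2) with 0 by ring; symmetry; apply sqrt_0).
    rewrite enorm_axis by lra; apply H.
    apply Rabs_def1; unfold minus, plus, opp; simpl; lra.
Qed.

Lemma radial_of_log_profile u x y :
  radial u -> (x, y) <> (0, 0) -> u x y = log_profile u (ln (enorm x y)).
Proof.
  intros hu h; unfold log_profile.
  rewrite exp_ln by (apply enorm_pos, h); apply radial_axis; auto.
Qed.

Lemma kink_limit_at_origin u a sgn :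
  radial u -> (sgn = 1 \/ sgn = -1) ->
  (forall t, log_profile u t = sgn * kink a (exp t) 0) ->
  limit_at_origin u (sgn * kink a 0 0).
Proof.
  intros hu hsgn hv; apply limit_at_origin_iff; auto; intros eps he.
  destruct (kink_limit a eps he) as [d [hd H]]; exists d; split; auto; intros r hr.
  specialize (hv (ln r)); unfold log_profile in hv; rewrite exp_ln in hv by lra.
  rewrite hv, <- Rmult_minus_distr_l, Rabs_mult.
  replace (Rabs sgn) with 1; [rewrite Rmult_1_l; auto |].
  destruct hsgn as [-> | ->]; [rewrite Rabs_pos_eq | rewrite Rabs_left]; lra.
Qed.

Lemma zero_limit_at_origin u :
  radial u -> (forall t, log_profile u t = 0) -> limit_at_origin u 0.
Proof.
  intros hu hv; apply limit_at_origin_iff; auto; intros eps he.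
  exists 1; split; [lra |]; intros r hr.
  specialize (hv (ln r)); unfold log_profile in hv; rewrite exp_ln in hv by lra.
  rewrite hv, Rminus_diag, Rabs_R0; auto.
Qed.

Lemma limit_at_origin_unique u l l' :
  radial u -> limit_at_origin u l -> limit_at_origin u l' -> l = l'.
Proof.
  intros hu h h'; rewrite limit_at_origin_iff in h, h' by auto.
  apply cond_eq; intros eps he.
  destruct (h (eps / 2)) as [d [hd H]]; [lra |].
  destruct (h' (eps / 2)) as [d' [hd' H']]; [lra |].
  assert (hm := Rmin_pos d d' hd hd'); assert (m1 := Rmin_l d d'); assert (m2 := Rmin_r d d').
  set (r := Rmin d d' / 2).
  assert (A : Rabs (u r 0 - l) < eps / 2) by (apply H; unfold r; lra).
  assert (A' : Rabs (u r 0 - l') < eps / 2) by (apply H'; unfold r; lra).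
  apply Rabs_def2 in A; apply Rabs_def2 in A'; apply Rabs_def1; lra.
Qed.

(** Subtracting periods sends [t] to minus infinity, that is, the radius to 0. *)
Lemma periodic_near_origin u T t d :
  positive_period (log_profile u) T -> 0 < d ->
  exists r, 0 < r < d /\ u r 0 = log_profile u t.
Proof.
  intros [hT hper] hd.
  assert (hn : forall n, log_profile u (t - INR n * T) = log_profile u t).
  { induction n as [| n IH]; [f_equal; simpl; ring |].
    rewrite <- IH, <- hper; f_equal; rewrite S_INR; ring. }
  destruct (nfloor_ex (Rabs ((t - ln d) / T)) (Rabs_pos _)) as [n [_ hlt]].
  exists (exp (t - INR (S n) * T)); split; [split; [apply exp_pos |] | apply hn].
  rewrite <- (exp_ln d hd); apply exp_increasing.
  assert (A := Rle_abs ((t - ln d) / T)); rewrite S_INR.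
  assert ((t - ln d) / T * T < (INR n + 1) * T) by (apply Rmult_lt_compat_r; lra).
  replace ((t - ln d) / T * T) with (t - ln d) in * by (field; lra); lra.
Qed.

(** Both [M] and [- M] are taken arbitrarily near the origin, and no [l] is within distance less
    than [M] of both. *)
Lemma oscillation_discontinuous u M phi C l :
  radial u -> 0 < M < 1 -> oscillation M (log_profile u) phi C ->
  ~ limit_at_origin u l.
Proof.
  intros hu hM ho hl.
  apply limit_at_origin_iff with (eps := M) in hl; [| auto | lra].
  destruct hl as [d [hd H]].
  destruct (oscillation_period _ _ _ _ hM ho) as [hp _].
  destruct (oscillation_max _ _ _ _ hM ho) as [[t1 h1] _].
  destruct (oscillation_min _ _ _ _ hM ho) as [[t2 h2] _].
  destruct (periodic_near_origin u _ t1 d hp hd) as [r1 [hr1 e1]].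
  destruct (periodic_near_origin u _ t2 d hp hd) as [r2 [hr2 e2]].
  assert (A1 := H r1 hr1); assert (A2 := H r2 hr2).
  rewrite e1, h1 in A1; rewrite e2, h2 in A2.
  apply Rabs_def2 in A1; apply Rabs_def2 in A2; lra.
Qed.

Lemma discontinuous_oscillation u :
  radial_solution u -> ~ continuous_at_origin u ->
  exists M phi C, 0 < M < 1 /\ oscillation M (log_profile u) phi C.
Proof.
  intros hu hd; assert (hrad : radial u) by apply hu.
  destruct (phase_ode_classification _ _ (radial_solution_phase_ode u hu))
    as [hz | [[a [sgn [hs hk]]] | ho]]; auto; exfalso; apply hd; eexists.
  - apply zero_limit_at_origin; auto.
  - apply kink_limit_at_origin; eauto.
Qed.

Lemma has_max_unique v M M' : has_max v M -> has_max v M' -> M = M'.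
Proof.
  intros [[t <-] h] [[t' <-] h']; apply Rle_antisym; auto.
Qed.

Lemma enorm_zero x y : enorm x y = 0 <-> (x, y) = (0, 0).
Proof.
  split.
  - intros h; apply sqrt_eq_0 in h; [| nra].
    f_equal; nra.
  - intros E; injection E as -> ->; unfold enorm.
    replace (0 ^ 2 + 0 ^ 2) with 0 by ring; apply sqrt_0.
Qed.
Theorem theorem1p1 :
  forall u : R -> R -> R, radial_solution u ->
    (forall l : R, limit_at_origin u l ->
       (forall x y, extend_at_origin u l x y = 0) \/
       (exists a sgn : R, (sgn = 1 \/ sgn = -1) /\
          forall x y, extend_at_origin u l x y = sgn * kink a x y))
    /\
    (~ continuous_at_origin u ->
       exists M T I : R,
         0 < M < 1 /\
         has_max (log_profile u) M /\
         has_min (log_profile u) (- M) /\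
         (forall u' : R -> R -> R,
            radial_solution u' -> ~ continuous_at_origin u' ->
            has_max (log_profile u') M -> has_min (log_profile u') (- M) ->
            exists s : R, forall t : R,
              log_profile u' t = log_profile u (t + s)) /\
         smallest_period (log_profile u) T /\
         is_RInt_gen (period_integrand M) (at_right (- M)) (at_left M) I /\
         T = 2 * I).
Proof.
  intros u hu; assert (hrad : radial u) by apply hu; split.
  - intros l hl.
    assert (hne : forall x y, enorm x y <> 0 -> (x, y) <> (0, 0)).
    { intros x y hxy E; apply hxy, enorm_zero, E. }
    destruct (phase_ode_classification _ _ (radial_solution_phase_ode u hu))
      as [hz | [[a [sgn [hs hk]]] | [M [phi [C [hM ho]]]]]].
    + left; intros x y; unfold extend_at_origin; destruct (Req_EM_T (enorm x y) 0) as [h | h].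
      * apply (limit_at_origin_unique u); auto; apply zero_limit_at_origin; auto.
      * rewrite radial_of_log_profile; auto.
    + right; exists a, sgn; split; auto; intros x y; rewrite kink_enorm.
      unfold extend_at_origin; destruct (Req_EM_T (enorm x y) 0) as [h | h].
      (* At the origin the extension takes the limit, which is the signed value of the kink
         there. *)
      * rewrite h; apply (limit_at_origin_unique u); auto; apply kink_limit_at_origin; auto.
      * rewrite radial_of_log_profile, hk, exp_ln; auto; apply enorm_pos; auto.
    + exfalso; exact (oscillation_discontinuous u M phi C l hrad hM ho hl).
  - intros hd; destruct (discontinuous_oscillation u hu hd) as [M [phi [C [hM ho]]]].
    exists M, (2 * elapsed M PI), (elapsed M PI).
    split; [exact hM |].
    split; [exact (oscillation_max _ _ _ _ hM ho) |].
    split; [exact (oscillation_min _ _ _ _ hM ho) |].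
    split; [| split; [exact (oscillation_period _ _ _ _ hM ho) |
              split; [exact (period_integral M hM) | reflexivity]]].
    intros u' hu' hd' hmax _.
    destruct (discontinuous_oscillation u' hu' hd') as [M' [phi' [C' [hM' ho']]]].
    (* The amplitude of an oscillation is its maximum, so both solutions share [M]. *)
    assert (E : M' = M) by exact (has_max_unique _ _ _ (oscillation_max _ _ _ _ hM' ho') hmax).
    subst M'; exists (C' - C).
    exact (oscillation_translate M _ phi C _ phi' C' hM ho ho').
Qed.
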